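(* If $\mu$ is a measure on a doubling metric space $X$ so that it satisfies the density point property, then $$\underline{\dim}_{\mathrm{loc}}(\mu,x)\le\underline{\dim}_1(\mu,x)\le\overline{\dim}_1(\mu,x)\le\overline{\dim}_{\mathrm{loc}}(\mu,x)$$ for $\mu$-almost all $x\in X$.
   Context: Let $(X,d)$ be a metric space. $B(x,r)=\{y\in X: d(x,y)\le r\}$ denotes the closed ball. $X$ is doubling if there is $N\in\mathbb{N}$ such that every closed ball $B(x,r)$ can be covered by $N$ balls of radius $r/2$. A measure on $X$ means a nontrivial Borel regular outer measure defined on all subsets of $X$ such that bounded sets have finite measure. $\operatorname{spt}(\mu)$ is the smallest closed set of full $\mu$-measure. $\mu$ has the density point property if $\lim_{r\downarrow0}\mu(A\cap B(x,r))/\mu(B(x,r))=1$ for $\mu$-almost all $x\in A$ whenever $A\subset X$ is $\mu$-measurable. The upper and lower local dimensions are $\overline{\dim}_{\mathrm{loc}}(\mu,x)=\limsup_{r\downarrow0}\log\mu(B(x,r))/\log r$ and $\underline{\dim}_{\mathrm{loc}}(\mu,x)=\liminf_{r\downarrow0}\log\mu(B(x,r))/\log r$. For $A\subset X$ with $\mu(A)>0$ the upper and lower entropy dimensions of $\mu$ on $A$ are $$\overline{\dim}_1(\mu,A)=\limsup_{\delta\downarrow0}\frac1{\mu(A)}\int_A\frac{\log\mu(B(y,\delta))}{\log\delta}\,d\mu(y),\qquad \underline{\dim}_1(\mu,A)=\liminf_{\delta\downarrow0}\frac1{\mu(A)}\int_A\frac{\log\mu(B(y,\delta))}{\log\delta}\,d\mu(y).$$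 The local upper and lower entropy dimensions at $x\in\operatorname{spt}(\mu)$ are $\overline{\dim}_1(\mu,x)=\limsup_{r\downarrow0}\overline{\dim}_1(\mu,B(x,r))$ and $\underline{\dim}_1(\mu,x)=\liminf_{r\downarrow0}\underline{\dim}_1(\mu,B(x,r))$. *)

(* Defs.v *)
From HB Require Import structures.
From mathcomp Require Import all_boot all_order all_algebra.
From mathcomp Require Import all_classical all_reals all_analysis.

Set Implicit Arguments.
Unset Strict Implicit.
Unset Printing Implicit Defensive.

Import Order.TTheory GRing.Theory Num.Theory.
Import numFieldNormedType.Exports.

Local Open Scope classical_set_scope.
Local Open Scope ring_scope.

(* [measurableType], hence the library's integral, requires a base point. A
   space carrying a nontrivial measure is nonempty, so nothing is lost, and no
   definition below mentions the base point. *)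
#[short(type="pmetricType")]
HB.structure Definition PMetric (K : numDomainType) :=
  { M of Metric K M & Pointed M }.

(* The library's [closed_ball] is the closure of the open ball, which may be
   strictly smaller than this set. *)
Definition cball (R : realType) (X : pmetricType R) (x : X) (r : R) : set X :=
  [set y | mdist x y <= r].

Definition doubling (R : realType) (X : pmetricType R) : Prop :=
  exists N : nat, forall (x : X) (r : R), 0 < r ->
    exists c : 'I_N -> X,
      cball x r `<=` \bigcup_(i in [set: 'I_N]) cball (c i) (r / 2).

Definition metric_bounded (R : realType) (X : pmetricType R) (A : set X) :
    Prop :=
  exists (x : X) (r : R), A `<=` cball x r.

Definition borel_set (R : realType) (X : pmetricType R) : set (set X) :=
  <<s @open X >>.

Definition borel_regular (R : realType) (X : pmetricType R)
    (mu : {outer_measure set X -> \bar R}) : Prop :=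
  @borel_set R X `<=` mu.-caratheodory /\
  forall A : set X, exists B : set X,
    [/\ borel_set B, A `<=` B & mu A = mu B].

Definition metric_measure (R : realType) (X : pmetricType R)
    (mu : {outer_measure set X -> \bar R}) : Prop :=
  [/\ mu [set: X] != 0%E,
      borel_regular mu
    & forall A : set X, metric_bounded A -> (mu A < +oo)%E].

(* [mu] as a measure on the sigma-algebra of its Caratheodory measurable
   sets: this is what integrals and "almost everywhere" refer to. *)
Definition cara_measure (R : realType) (X : pmetricType R)
    (mu : {outer_measure set X -> \bar R}) :
    {measure set (caratheodory_type mu) -> \bar R} :=
  mu : set (caratheodory_type mu) -> \bar R.

Local Open Scope ereal_scope.

Definition density_point_property (R : realType) (X : pmetricType R)
    (mu : {outer_measure set X -> \bar R}) : Prop :=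
  forall A : set X, mu.-caratheodory A ->
    {ae cara_measure mu, forall x : X, A x ->
      mu (A `&` cball x r) / mu (cball x r) @[r --> (0%R : R)^'+] --> 1}.

(* For [0 < r < 1] this is [+oo] when the ball is null. *)
Definition dim_quotient (R : realType) (X : pmetricType R)
    (mu : {outer_measure set X -> \bar R}) (x : X) (r : R) : \bar R :=
  lne (mu (cball x r)) / (ln r)%:E.

Definition upper_dim_loc (R : realType) (X : pmetricType R)
    (mu : {outer_measure set X -> \bar R}) (x : X) : \bar R :=
  limf_esup (dim_quotient mu x) (0%R : R)^'+.

Definition lower_dim_loc (R : realType) (X : pmetricType R)
    (mu : {outer_measure set X -> \bar R}) (x : X) : \bar R :=
  limf_einf (dim_quotient mu x) (0%R : R)^'+.

(* Meaningful for [0 < mu A < +oo]. *)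
Definition entropy_mean (R : realType) (X : pmetricType R)
    (mu : {outer_measure set X -> \bar R}) (A : set X) (delta : R) : \bar R :=
  (mu A)^-1 * \int[cara_measure mu]_(y in A) dim_quotient mu y delta.

Definition upper_dim1 (R : realType) (X : pmetricType R)
    (mu : {outer_measure set X -> \bar R}) (A : set X) : \bar R :=
  limf_esup (entropy_mean mu A) (0%R : R)^'+.

Definition lower_dim1 (R : realType) (X : pmetricType R)
    (mu : {outer_measure set X -> \bar R}) (A : set X) : \bar R :=
  limf_einf (entropy_mean mu A) (0%R : R)^'+.

(* Meaningful for [x] in the support of [mu], where all balls around [x] have
   positive measure. Off the support the local entropy dimensions are [0] and
   the local dimensions are [+oo], so that
   [lower_dim_loc mu x <= lower_dim1_loc mu x] fails there. *)
Definition upper_dim1_loc (R : realType) (X : pmetricType R)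
    (mu : {outer_measure set X -> \bar R}) (x : X) : \bar R :=
  limf_esup (fun r : R => upper_dim1 mu (cball x r)) (0%R : R)^'+.

Definition lower_dim1_loc (R : realType) (X : pmetricType R)
    (mu : {outer_measure set X -> \bar R}) (x : X) : \bar R :=
  limf_einf (fun r : R => lower_dim1 mu (cball x r)) (0%R : R)^'+.

(* Main.v *)
Require Import Defs.
From HB Require Import structures.
From mathcomp Require Import all_boot all_order all_algebra.
From mathcomp Require Import all_classical all_reals all_analysis.
From mathcomp Require Import measurable_realfun lra.

Set Implicit Arguments.
Unset Strict Implicit.
Unset Printing Implicit Defensive.

Import Order.TTheory GRing.Theory Num.Theory.
Import numFieldNormedType.Exports.

Local Open Scope classical_set_scope.
Local Open Scope ring_scope.
Local Open Scope ereal_scope.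

(** Write q_d(y) for log mu(B(y, d)) / log d. The entropy dimensions at x are
    limits of averages of q_d over B(x, r), with d tending to 0 before r. The
    idea is to compare them with the local dimensions on sets where a bound on
    q_d holds uniformly in d, and to use the density point property to make the
    rest of the ball negligible.

    For a rational s >= 0 and a natural number k let L be the set of the points
    y with q_d(y) >= s for all d < 1/(k+1). If x is a density point of L, then
    the average of q_d over B(x, r) is at least s mu(L /\ B(x, r)) / mu(B(x, r))
    minus an error that vanishes with d, because q_d is bounded below by a
    quantity tending to 0 uniformly on bounded sets
    ([near0_dim_quotient_ge]). Hence the lower entropy dimension at x is at
    least s ([lower_dim1_loc_ge]). If s is less than the lower local dimension
    at x, then x lies in some L. There are countably many such sets L, so
    almost every x is a density point of each of them that contains it.

    For the upper bound let U be the set of the points y with q_d(y) <= t for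
    all d < 1/(k+1). On B(x, r) \ U there is no such bound on q_d, and a small
    set could a priori carry a large share of the integral. This is where
    doubling enters: for a constant D depending on the space only, the integral
    of the positive part of q_d over any measurable A inside a ball is at most
    D mu(A) + o(1) ([doubling_entropy_bound]). Indeed, A is covered by at most
    C d^(-D) sets of diameter at most d, with C depending on the ball; a piece of mass p contributes at most
    - p log p / |log d|, which is at most D p + d^D / |log d|
    ([neg_mul_ln_le]); and the sum of the last terms is at most C / |log d|.
    So B(x, r) \ U contributes at most D mu(B(x, r) \ U) in the limit, and this
    is negligible compared with mu(B(x, r)) at density points of U
    ([upper_dim1_loc_le]).

    The sets L and U are closed ([closed_dim_quotient_ge],
    [closed_dim_quotient_le]), hence measurable. *)

(** * Extended reals, logarithms and limits superior *)

Section extended_reals.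
Context {R : realType}.
Implicit Types (d t : R).

Lemma lne_ge (c : R) (m : \bar R) : 0 <= m -> (c%:E <= lne m) = ((expR c)%:E <= m).
Proof.
case: m => [m| |]//; last by rewrite !leey.
rewrite lee_fin /= => m0; have [mle0|mgt0] := leP m 0%R.
  rewrite leeNy_eq /= lee_fin leNgt; apply/esym/negbTE; rewrite negbK.
  exact: le_lt_trans mle0 (expR_gt0 _).
by rewrite !lee_fin -ler_expR lnK.
Qed.

Lemma lne_le (c : R) (m : \bar R) : 0 <= m -> (lne m <= c%:E) = (m <= (expR c)%:E).
Proof.
case: m => [m| |]//=; rewrite lee_fin => m0; have [mle0|mgt0] := leP m 0%R.
  by rewrite leNye lee_fin (le_trans mle0)// expR_ge0.
by rewrite !lee_fin -[in RHS](lnK mgt0) ler_expR.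
Qed.

(** An infinite numerator is allowed: dividing by a negative number reverses
    the order and exchanges the two infinities. *)
Lemma lee_ndivr (a : \bar R) (k t : R) : (k < 0)%R ->
  (a / k%:E <= t%:E) = ((t * k)%:E <= a).
Proof.
move=> k0; rewrite inver lt_eqF//.
have ki : Num.sg k^-1 = (-1)%R by rewrite ltr0_sg// invr_lt0.
case: a => [a| |].
- by rewrite -EFinM !lee_fin ler_ndivrMr.
- by rewrite mulyr ki mulN1e leNye leey.
- by rewrite mulNyr ki mulN1e /= leye_eq leeNy_eq.
Qed.

Lemma lee_ndivl (a : \bar R) (k t : R) : (k < 0)%R ->
  (t%:E <= a / k%:E) = (a <= (t * k)%:E).
Proof.
move=> k0; rewrite inver lt_eqF//.
have ki : Num.sg k^-1 = (-1)%R by rewrite ltr0_sg// invr_lt0.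
case: a => [a| |].
- by rewrite -EFinM !lee_fin ler_ndivlMr.
- by rewrite mulyr ki mulN1e leye_eq leeNy_eq.
- by rewrite mulNyr ki mulN1e /= leNye leey.
Qed.

Lemma cvg_powRl (t : R) d : (0 < d)%R -> (u `^ t)%R @[u --> d] --> (d `^ t)%R.
Proof.
move=> d0; rewrite [X in _ --> X]/powR gt_eqF//.
have : expR (t * ln u)%R @[u --> d] --> expR (t * ln d)%R.
  apply: continuous_cvg; first exact: continuous_expR.
  by apply: cvgMr; exact: continuous_ln.
apply: cvg_trans; apply: near_eq_cvg; near=> u.
rewrite /powR gt_eqF//; near: u; exact: lt_nbhsr.
Unshelve. all: by end_near. Qed.

Lemma near0_ln_le (c : R) : \forall d \near (0%R : R)^'+, (ln d <= c)%R.
Proof.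
near=> d; rewrite -[leRHS]expRK ler_ln ?posrE ?expR_gt0//.
all: near: d; by [exact: nbhs_right_gt | apply: nbhs_right_le; exact: expR_gt0].
Unshelve. all: by end_near. Qed.

Lemma near0_lt1 : \forall d \near (0%R : R)^'+, (0 < d < 1)%R.
Proof.
near=> d; apply/andP; split; near: d; [exact: nbhs_right_gt|exact: nbhs_right_lt].
Unshelve. all: by end_near. Qed.

(** A pointwise form of the bound of entropy by the logarithm of the number of
    atoms. From log u <= u with u = e^(- D L) / p one gets
    - log p <= D L + e^(- D L) / p; multiply by p / L. With L = - log d the last
    term becomes d^D / |log d|, which is summable over about d^(-D) pieces. *)
Lemma neg_mul_ln_le (p L D : R) : (0 < p)%R -> (0 < L)%R ->
  (- ln p / L * p <= D * p + expR (- (D * L)) / L)%R.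
Proof.
move=> p0 L0; rewrite mulrAC ler_pdivrMr// mulrDl divfK ?gt_eqF//.
have := expR_ge1Dx (- (D * L) - ln p); rewrite expRB lnK// => h.
have : (- (D * L) - ln p <= expR (- (D * L)) / p)%R by apply: le_trans h; rewrite lerDr.
rewrite ler_pdivlMr//; nra.
Qed.

Lemma dyadic_between (a : R) : (1 <= a)%R -> exists k : nat, (a <= 2 ^+ k <= 2 * a)%R.
Proof.
move=> a1; have ex : exists k : nat, (a <= 2 ^+ k)%R.
  exists (Num.bound a); rewrite (le_trans (ltW (archi_boundP _)))//.
    by rewrite (le_trans _ a1).
  by rewrite -natrX ler_nat ltnW// ltn_expl.
case: (ex_minnP ex) => k ak kmin; exists k; rewrite ak /=.
case: k ak kmin => [|k] _ kmin; first by rewrite expr0; lra.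
rewrite exprS ler_pM2l// leNgt; apply/negP => ka.
by have := kmin k (ltW ka); rewrite ltnn.
Qed.

Lemma ereal_rat_between (a b : \bar R) : 0 <= a -> a < b ->
  exists q : rat, a < (ratr q)%:E < b.
Proof.
case: a => [a| |]// _; last by rewrite ltNge leey.
case: b => [b| |]// ab; first by have [q] := rat_in_itvoo ab; rewrite in_itv; exists q.
have [|q] := @rat_in_itvoo R a (a + 1)%R; first by rewrite ltrDl.
by rewrite in_itv /= => /andP[aq _]; exists q; rewrite lte_fin aq ltry.
Qed.

Lemma near0_harmonic (P : R -> Prop) :
  (\forall d \near (0%R : R)^'+, P d) ->
  exists k : nat, forall d, (0 < d < k.+1%:R^-1)%R -> P d.
Proof.
move=> [e /= e0 eP]; have [k] := ltr_add_invr e0; rewrite add0r => ke.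
exists k => d /andP[d0 dk]; apply: eP => //=.
by rewrite sub0r normrN gtr0_norm// (lt_trans dk).
Qed.

End extended_reals.

Section limf.
Context {R : realType} {I : choiceType} {T : filteredType I}.
Implicit Types (f : T -> \bar R) (F : set_system T) (c : \bar R).

Lemma limf_esup_le f F c : (\forall x \near F, f x <= c) -> limf_esup f F <= c.
Proof.
move=> Fc; apply: ge_ereal_inf; exists (ereal_sup (f @` [set x | f x <= c])).
  by exists [set x | f x <= c].
by apply: ge_ereal_sup => _ [x /= ? <-].
Qed.

Lemma limf_einf_ge f F c : Filter F ->
  (\forall x \near F, c <= f x) -> c <= limf_einf f F.
Proof.
move=> FF Fc; rewrite /limf_einf leeNr; apply: limf_esup_le.
by apply: filterS Fc => x; rewrite leeN2.
Qed.

Lemma limf_esup_lt f F c : Filter F ->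
  limf_esup f F < c -> \forall x \near F, f x < c.
Proof.
move=> FF /ereal_inf_lt[_ [V FV <-]] Vc; apply: filterS FV => x Vx.
by apply: le_lt_trans Vc; apply: ereal_sup_ubound; exists x.
Qed.

Lemma limf_einf_gt f F c : Filter F ->
  c < limf_einf f F -> \forall x \near F, c < f x.
Proof.
move=> FF; rewrite /limf_einf lteNr => /limf_esup_lt Fc.
by apply: filterS Fc => x; rewrite lteN2.
Qed.

Lemma limf_einf_le_esup f F : ProperFilter F -> limf_einf f F <= limf_esup f F.
Proof.
move=> FF; rewrite limf_einfE; apply: ge_ereal_sup => _ [V FV <-].
apply: le_ereal_inf_tmp => _ [W FW <-].
have [x [Vx Wx]] := filter_ex (filterI FV FW).
apply: (@le_trans _ _ (f x)).
  by apply: ereal_inf_lbound; exists x.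
by apply: ereal_sup_ubound; exists x.
Qed.

Lemma le_limf_esup f g F : (forall x, f x <= g x) -> limf_esup f F <= limf_esup g F.
Proof.
move=> fg; apply: le_ereal_inf_tmp => _ [V FV <-].
apply: ge_ereal_inf; exists (ereal_sup (f @` V)); first by exists V.
apply: ge_ereal_sup => _ [x Vx <-]; apply: (le_trans (fg x)).
by apply: ereal_sup_ubound; exists x.
Qed.

End limf.

Lemma ae_forall_countable d (T : measurableType d) (R : realType)
    (mu : {measure set T -> \bar R}) (I : countType) (P : I -> T -> Prop) :
  (forall i, {ae mu, forall x, P i x}) -> {ae mu, forall x, forall i, P i x}.
Proof.
move=> aeP.
have : {ae mu, forall x, forall n, if @unpickle I n is Some i then P i x else True}.
  by apply: ae_foralln => n; case: unpickle => [i|]; [exact: aeP|exact: aeW].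
by apply: filterS => x Px i; have := Px (pickle i); rewrite pickleK.
Qed.

(** * Closed balls and coverings in a doubling space *)

Section closed_balls.
Context {R : realType} {X : pmetricType R}.
Implicit Types (x y : X) (r s : R) (A : set X).

Lemma cball_triangle x y r s :
  (mdist x y + r <= s)%R -> cball y r `<=` cball x s.
Proof.
move=> h z; rewrite /cball /= => yz.
by rewrite (le_trans _ h)// (le_trans (metric_triangle x y z))// lerD2l.
Qed.

Lemma cball_center x r : (0 <= r)%R -> cball x r x.
Proof. by rewrite /cball /= mdistxx. Qed.

Lemma closure_mdist A y : closure A y <->
  forall e : R, (0 < e)%R -> exists x, A x /\ (mdist y x < e)%R.
Proof.
split=> [Ay e e0|Ay].
  have [x [Ax]] := Ay _ (nbhsx_ballx y e e0).
  by rewrite ballEmdist /= => yx; exists x.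
move=> B /nbhs_ballP[e /= e0 eB].
have [x [Ax yx]] := Ay _ e0.
by exists x; split=> //; apply: eB; rewrite ballEmdist.
Qed.

Lemma closed_cball x r : closed (cball x r).
Proof.
move=> y /closure_mdist cy; rewrite /cball /=.
apply/ler_addgt0Pr => e e0; have [z [xz yz]] := cy _ e0.
rewrite (le_trans (metric_triangle x z y))// lerD// metric_sym; exact: ltW.
Qed.

End closed_balls.

Section cover.
Context {R : realType} {X : pmetricType R}.

(** The doubling constant N is replaced by the larger number 2 ^ N, so that the
    size of the cover becomes a power of the scale with a natural exponent. *)
Lemma doubling_cover : doubling X -> exists D : nat, forall (x : X) (r : R) (k : nat),
  (0 < r)%R -> exists s : seq X, (size s <= (2 ^ k) ^ D)%N /\
    cball x r `<=` [set y | exists2 c, c \in s & cball c (r / 2 ^+ k) y].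
Proof.
move=> [N dN]; exists N => x r k r0; elim: k => [|k [s [ss xs]]].
  exists [:: x]; split; first by rewrite exp1n.
  by move=> y xy; exists x; rewrite ?inE// expr0 divr1.
have rk0 : (0 < r / 2 ^+ k)%R by rewrite divr_gt0// exprn_gt0.
pose cen c := projT1 (cid (dN c _ rk0)).
exists [seq cen c i | c <- s, i <- enum 'I_N]; split.
  rewrite size_allpairs size_enum_ord expnSr expnMn leq_mul// ltnW// ltn_expl//.
move=> y /xs[c cs cy]; have := projT2 (cid (dN c _ rk0)); rewrite -/(cen c).
move=> /(_ _ cy)[i _ iy]; exists (cen c i).
  by apply: allpairs_f => //; rewrite mem_enum.
by rewrite exprSr invfM mulrA.
Qed.

(** The balls have radius d / 2 in order to have diameter at most d: any point
    of such a ball sees the whole ball within distance d. *)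
Lemma doubling_cover_scale : doubling X -> exists D : nat, forall (x : X) (r d : R),
  (0 < r)%R -> (0 < d <= r)%R -> exists s : seq X,
    ((size s)%:R * d `^ D%:R <= (4 * r) ^+ D)%R /\
    cball x r `<=` [set y | exists2 c, c \in s & cball c (d / 2) y].
Proof.
move=> /doubling_cover[D dD]; exists D => x r d r0 /andP[d0 dr].
have [|k /andP[k1 k2]] := @dyadic_between R (2 * r / d)%R.
  (* 2 ^ k between 2 r / d and 4 r / d gives the radius r / 2 ^ k <= d / 2 and
     the size (2 ^ k) ^ D <= (4 r / d) ^ D. *)
  by rewrite ler_pdivlMr//; lra.
have [s [ss xs]] := dD x r k r0; exists s; split; last first.
  move=> y /xs[c cs cy]; exists c => //; apply: le_trans cy _.
  rewrite ler_pdivrMr ?exprn_gt0//; move: k1; rewrite ler_pdivrMr//; lra.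
rewrite powR_mulrn ?(ltW d0)//.
apply: (@le_trans _ _ ((2 ^+ k * d) ^+ D)%R).
  by rewrite exprMn ler_pM2r ?exprn_gt0// -!natrX ler_nat.
rewrite lerXn2r ?nnegrE ?mulr_ge0 ?exprn_ge0 ?(ltW d0) ?(ltW r0)//.
by move: k2; rewrite mulrA ler_pdivlMr//; lra.
Qed.

End cover.

(** * The quotient of logarithms as a function of the point *)

Section dimension_quotient.
Context {R : realType} {X : pmetricType R}.
Variable mu : {outer_measure set X -> \bar R}.
Implicit Types (x y : X) (r s t d e : R) (A E : set X).

Lemma dim_quotient_le x d t : (0 < d < 1)%R ->
  (dim_quotient mu x d <= t%:E) = ((d `^ t)%:E <= mu (cball x d)).
Proof.
move=> d01; have /andP[d0 _] := d01.
rewrite /dim_quotient lee_ndivr ?ln_lt0// lne_ge ?outer_measure_ge0//.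
by rewrite /powR gt_eqF.
Qed.

Lemma dim_quotient_ge x d t : (0 < d < 1)%R ->
  (t%:E <= dim_quotient mu x d) = (mu (cball x d) <= (d `^ t)%:E).
Proof.
move=> d01; have /andP[d0 _] := d01.
rewrite /dim_quotient lee_ndivl ?ln_lt0// lne_le ?outer_measure_ge0//.
by rewrite /powR gt_eqF.
Qed.

(** A limit y of points of the set inherits the bound on mu(B(y, d)) from
    nearby points x, because B(y, d) contains B(x, d') for d' < d, and the power
    d' ^ t is continuous in d'. The condition at all scales is what makes this
    work. *)
Lemma closed_dim_quotient_le t e : (e <= 1)%R ->
  closed [set x | forall d, (0 < d < e)%R -> dim_quotient mu x d <= t%:E].
Proof.
move=> e1 y /closure_mdist cy /= d /andP[d0 de].
have d1 : (d < 1)%R by exact: lt_le_trans de e1.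
rewrite dim_quotient_le ?d0//.
have h : (d' `^ t)%:E @[d' --> d^'-] --> (d `^ t)%:E.
  apply: cvg_EFin; first by near=> z.
  exact/cvg_at_left_filter/cvg_powRl.
apply: (cvge_to_le h); near=> d'.
have d'0 : (0 < d')%R by near: d'; exact: nbhs_left_gt.
have d'd : (d' < d)%R by near: d'; exact: nbhs_left_lt.
have [|x [Ex yx]] := cy (d - d')%R; first by rewrite subr_gt0.
have := Ex d'; rewrite d'0 (lt_trans d'd de) => /(_ isT).
rewrite dim_quotient_le ?d'0 ?(lt_trans d'd d1)// => /le_trans; apply.
by apply: le_outer_measure; apply: cball_triangle; rewrite -lerBrDr ltW.
Unshelve. all: by end_near. Qed.

(** Same argument with slightly larger balls around the nearby points; the
    strict bound d < e leaves room for them. *)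
Lemma closed_dim_quotient_ge s e : (e <= 1)%R ->
  closed [set x | forall d, (0 < d < e)%R -> s%:E <= dim_quotient mu x d].
Proof.
move=> e1 y /closure_mdist cy /= d /andP[d0 de].
have d1 : (d < 1)%R by exact: lt_le_trans de e1.
rewrite dim_quotient_ge ?d0//.
have h : (d' `^ s)%:E @[d' --> d^'+] --> (d `^ s)%:E.
  apply: cvg_EFin; first by near=> z.
  exact/cvg_at_right_filter/cvg_powRl.
apply: (cvge_to_ge h); near=> d'.
have d'd : (d < d')%R by near: d'; exact: nbhs_right_gt.
have d'e : (d' < e)%R by near: d'; exact: nbhs_right_lt.
have [|x [Ex yx]] := cy (d' - d)%R; first by rewrite subr_gt0.
have d'0 : (0 < d')%R by exact: lt_trans d'd.
have := Ex d'; rewrite d'0 d'e => /(_ isT).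
rewrite dim_quotient_ge ?d'0 ?(lt_le_trans d'e e1)//; apply: le_trans.
by apply: le_outer_measure; apply: cball_triangle; rewrite -lerBrDr metric_sym ltW.
Unshelve. all: by end_near. Qed.

Hypothesis mmu : metric_measure mu.

Let finB : forall x r, mu (cball x r) < +oo.
Proof. by case: mmu => _ _ h x r; apply: h; exists x, r. Qed.

Let fin_num_sub_cball A x r : A `<=` cball x r -> mu A \is a fin_num.
Proof.
move=> Ax; rewrite ge0_fin_numE ?outer_measure_ge0//.
by apply: le_lt_trans (finB x r); exact: le_outer_measure.
Qed.

Lemma closed_caratheodory A : closed A -> mu.-caratheodory A.
Proof.
case: mmu => _ [bor _] _ cA; rewrite -(setCK A).
apply: caratheodory_measurable_setC; apply: bor; apply: sub_sigma_algebra.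
exact: closed_openC.
Qed.

Lemma measurable_cball x r : mu.-cara.-measurable (cball x r).
Proof. exact/closed_caratheodory/closed_cball. Qed.

(** Upper semicontinuity of the mass of closed balls of a fixed radius: nearby
    balls are contained in slightly larger balls around y, whose masses decrease
    to mu(B(y, d)) as bounded sets have finite measure. *)
Lemma closed_cball_mass_ge d (c : \bar R) : (0 < d)%R ->
  closed [set y | c <= mu (cball y d)].
Proof.
move=> d0 y /closure_mdist cy /=.
pose F n := cball y (d + n.+1%:R^-1)%R.
have mF n : mu.-cara.-measurable (F n) by exact: measurable_cball.
have capF : \bigcap_n F n = cball y d.
  apply/seteqP; split=> [z Fz|z yz n _]; last first.
    by rewrite /F /cball /= (le_trans yz)// lerDl.
  rewrite /cball /=; apply/ler_addgt0Pr => e e0.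
  have [n ne] : exists n : nat, (n.+1%:R^-1 < e)%R.
    by have [n] := ltr_add_invr e0; rewrite add0r => ?; exists n.
  by apply: (le_trans (Fz n I)); rewrite lerD2l ltW.
have := @nonincreasing_cvg_mu _ _ _ (cara_measure mu) F (finB _ _) mF.
rewrite capF => /(_ (measurable_cball _ _)) cvF.
apply: (cvge_to_ge (cvF _)).
  move=> m n mn; apply/subsetPset; apply: cball_triangle.
  by rewrite mdistxx add0r lerD2l lef_pV2 ?posrE// ler_nat.
near=> n; have [|x [cx yx]] := cy (n.+1%:R^-1)%R; first by rewrite invr_gt0.
apply: (le_trans cx); apply: le_outer_measure; apply: cball_triangle.
by rewrite addrC lerD2l ltW.
Unshelve. all: by end_near. Qed.

Lemma measurable_dim_quotient d : (0 < d)%R ->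
  measurable_fun [set: caratheodory_type mu]
    (dim_quotient mu ^~ d : caratheodory_type mu -> \bar R).
Proof.
move=> d0; rewrite /dim_quotient; under eq_fun do rewrite muleC.
apply: measurable_funeM.
apply: (measurability _ (ErealGenCInfty.measurableE R)).
move=> _ [_ [c ->] <-]; rewrite setTI.
apply: closed_caratheodory.
rewrite (_ : _ @^-1` _ = [set y | (expR c)%:E <= mu (cball y d)]).
  exact: closed_cball_mass_ge.
by apply/seteqP; split=> y /=; rewrite in_itv /= andbT lne_ge ?outer_measure_ge0.
Qed.

(** The quotient may be negative where balls have mass larger than 1, but the
    masses of small balls with centre in B(x, r) are all at most
    K = mu(B(x, r + 1)), and log K / log d tends to 0. *)
Lemma near0_dim_quotient_ge x r e : (0 < e)%R ->
  \forall d \near (0%R : R)^'+, forall y,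
    cball x r y -> (- e)%:E <= dim_quotient mu y d.
Proof.
move=> e0; have [K K0 rK] : exists2 K, (0 <= K)%R & mu (cball x (r + 1)) = K%:E.
  exists (fine (mu (cball x (r + 1)))); first by rewrite fine_ge0// outer_measure_ge0.
  by rewrite fineK// (@fin_num_sub_cball _ x (r + 1)%R).
near=> d => y xy.
have d01 : (0 < d < 1)%R by near: d; exact: near0_lt1.
have /andP[d0 d1] := d01.
rewrite dim_quotient_ge//; apply: (@le_trans _ _ K%:E).
  rewrite -rK; apply: le_outer_measure; apply: cball_triangle.
  by rewrite lerD// ltW.
(* The crude bound K <= exp K spares the case K = 0. *)
rewrite lee_fin /powR gt_eqF//; apply: (@le_trans _ _ (expR K)).
  by apply: le_trans (expR_ge1Dx K); rewrite lerDr.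
rewrite ler_expR mulNr -mulrN -ler_pdivrMl// lerNr.
near: d; exact: near0_ln_le.
Unshelve. all: by end_near. Qed.

(** * Integrals of the quotient *)

Let mq d A : (0 < d)%R -> mu.-caratheodory A ->
  measurable_fun (A : set (caratheodory_type mu))
    (dim_quotient mu ^~ d : caratheodory_type mu -> \bar R).
Proof. by move=> d0 mA; apply: measurable_funTS; exact: measurable_dim_quotient. Qed.

(** Every ball B(y, d) with y in A contains A, so the quotient on A is at most
    log(mu A) / log d. *)
Lemma integral_dim_quotient_small_set (D d : R) A : (0 <= D)%R -> (0 < d < 1)%R ->
  mu.-caratheodory A -> mu A < +oo ->
  (forall y, A y -> A `<=` cball y d) ->
  \int[cara_measure mu]_(y in A) (dim_quotient mu ^~ d)^\+ y <=
  D%:E * mu A + (d `^ D / - ln d)%:E.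
Proof.
move=> D0 d01 mA Aoo Ad; have /andP[d0 d1] := d01.
have L0 : (0 < - ln d)%R by rewrite oppr_gt0 ln_lt0.
have mqp : measurable_fun (A : set (caratheodory_type mu))
    ((dim_quotient mu ^~ d)^\+ : caratheodory_type mu -> \bar R).
  by apply: measurable_funepos; exact: mq.
have R0 : 0 <= D%:E * mu A + (d `^ D / - ln d)%:E.
  by rewrite adde_ge0 ?mule_ge0 ?outer_measure_ge0// lee_fin divr_ge0 ?powR_ge0// ltW.
have [A0|A0] := eqVneq (mu A) 0.
  by rewrite null_set_integral.
have [p p0 pE] : exists2 p, (0 < p)%R & mu A = p%:E.
  have Afin : mu A \is a fin_num by rewrite ge0_fin_numE// outer_measure_ge0.
  exists (fine (mu A)); last by rewrite fineK.
  by rewrite fine_gt0// Aoo lt0e A0 outer_measure_ge0.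
pose m := Num.max (ln p / ln d)%R 0%R.
apply: (@le_trans _ _ (\int[cara_measure mu]_(y in A) cst m%:E y)).
  apply: ge0_le_integral => // y Ay.
  rewrite funeposE ge_max lee_fin le_max lexx orbT andbT.
  rewrite dim_quotient_le//; apply: (@le_trans _ _ (mu A)).
    rewrite pE lee_fin /powR gt_eqF// -[leRHS](lnK p0) ler_expR.
    by rewrite -ler_ndivrMr ?ln_lt0// le_max lexx.
  exact/le_outer_measure/Ad.
rewrite integral_cst// (_ : cara_measure mu A = p%:E)// pE -!EFinM -EFinD lee_fin /m.
have [h|h] := leP (ln p / ln d)%R 0%R.
  by rewrite mul0r addr_ge0 ?mulr_ge0 ?powR_ge0 ?invr_ge0 ?(ltW p0) ?(ltW L0).
rewrite /powR gt_eqF//.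
have := @neg_mul_ln_le R p (- ln d) D p0 L0.
by rewrite mulrN opprK invrN mulrNN.
Qed.

(** The cover is made disjoint one ball at a time, and every piece costs one
    error term d^D / |log d|. *)
Lemma integral_dim_quotient_cover (D d : R) (s : seq X) A :
  (0 <= D)%R -> (0 < d < 1)%R ->
  mu.-caratheodory A -> mu A < +oo ->
  A `<=` [set y | exists2 c, c \in s & cball c (d / 2) y] ->
  \int[cara_measure mu]_(y in A) (dim_quotient mu ^~ d)^\+ y <=
  D%:E * mu A + ((size s)%:R * (d `^ D / - ln d))%:E.
Proof.
move=> D0 d01; have /andP[d0 _] := d01.
elim: s A => [|c s ih] A mA Aoo As.
  have -> : A = set0 by apply/seteqP; split=> // y /As[].
  by rewrite integral_set0 outer_measure0 mule0 add0e mul0r.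
pose B := A `&` cball c (d / 2); pose C := A `\` cball c (d / 2).
have mc : mu.-caratheodory (cball c (d / 2)) by exact: measurable_cball.
have mB : mu.-caratheodory B by exact: caratheodory_measurable_setI.
have mC : mu.-caratheodory C by exact: caratheodory_measurable_setD.
have Boo : mu B < +oo.
  by apply: le_lt_trans Aoo; apply: le_outer_measure; apply: subIsetl.
have Coo : mu C < +oo.
  by apply: le_lt_trans Aoo; apply: le_outer_measure; apply: subDsetl.
have AE : A = B `|` C by rewrite /B /C setUIDK.
have muA : mu A = mu B + mu C by rewrite /C setDE; exact: mc.
rewrite {1}AE ge0_integral_setU//=; last 2 first.
  by rewrite -AE; apply: measurable_funepos; exact: mq.
  by apply/disj_setPS => y [[_ ?] [_]].
have hB : \int[cara_measure mu]_(y in B) (dim_quotient mu ^~ d)^\+ y <=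
    D%:E * mu B + (d `^ D / - ln d)%:E.
  apply: integral_dim_quotient_small_set => // y [_ cy] z [_ cz].
  rewrite /cball /= (le_trans (metric_triangle y c z))//.
  by rewrite (splitr d) lerD// metric_sym.
have hC : \int[cara_measure mu]_(y in C) (dim_quotient mu ^~ d)^\+ y <=
    D%:E * mu C + ((size s)%:R * (d `^ D / - ln d))%:E.
  apply: ih => // y [/As[c' + c'y] ncy]; rewrite inE => /predU1P[c'E|c's].
    by case: ncy; rewrite -c'E.
  by exists c'.
apply: (le_trans (leeD hB hC)).
rewrite muA muleDr//; last by rewrite ge0_adde_def// inE outer_measure_ge0.
by rewrite addeACA -EFinD -nat1r mulrDl mul1r.
Qed.

(** This implies that the upper entropy dimension of mu on any bounded set of
    positive measure is at most D; multiplying by the mass makes the bound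
    meaningful for null sets as well. *)
Definition entropy_bound (D : nat) : Prop := forall x r e A,
  (0 < r)%R -> (0 < e)%R -> mu.-caratheodory A -> A `<=` cball x r ->
  \forall d \near (0%R : R)^'+,
    \int[cara_measure mu]_(y in A) (dim_quotient mu ^~ d)^\+ y <=
      D%:R%:E * mu A + e%:E.

Lemma doubling_entropy_bound : doubling X -> exists D, entropy_bound D.
Proof.
move=> /doubling_cover_scale[D dD]; exists D => x r e A r0 e0 mA Ax.
near=> d; have d01 : (0 < d < 1)%R by near: d; exact: near0_lt1.
have /andP[d0 d1] := d01.
have [|s [ss xs]] := dD x r d r0.
  by rewrite d0 /=; near: d; exact: nbhs_right_le.
have Aoo : mu A < +oo by apply: le_lt_trans (finB x r); exact: le_outer_measure.
have := integral_dim_quotient_cover (ler0n _ D) d01 mA Aoo (subset_trans Ax xs).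
move=> /le_trans; apply; rewrite leeD2l// lee_fin mulrA.
have L0 : (0 < - ln d)%R by rewrite oppr_gt0 ln_lt0.
rewrite ler_pdivrMr//; apply: (le_trans ss).
rewrite -ler_pdivrMl// lerNr; near: d; exact: near0_ln_le.
Unshelve. all: by end_near. Qed.

(** The integral is split along E: inside E the quotient is at most t, and
    outside the entropy bound applies. *)
Lemma integral_ball_le (D : nat) x r E t e' e :
  entropy_bound D -> (0 < r)%R ->
  mu.-caratheodory E -> (0 <= t)%R -> (0 < e')%R ->
  (forall y d, E y -> (0 < d < e')%R -> dim_quotient mu y d <= t%:E) ->
  (0 < e)%R -> \forall d \near (0%R : R)^'+,
    \int[cara_measure mu]_(y in cball x r) dim_quotient mu y d <=
    t%:E * mu (E `&` cball x r) + D%:R%:E * mu (cball x r `\` E) + e%:E.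
Proof.
move=> hD r0 mE t0 e'0 Et e0.
have mB : mu.-caratheodory (cball x r) by exact: measurable_cball.
have mEB : mu.-caratheodory (E `&` cball x r) by exact: caratheodory_measurable_setI.
have mBE : mu.-caratheodory (cball x r `\` E) by exact: caratheodory_measurable_setD.
near=> d.
have d0 : (0 < d)%R by near: d; exact: nbhs_right_gt.
have de' : (d < e')%R by near: d; exact: nbhs_right_lt.
rewrite integralE; apply: (@le_trans _ _ (\int[cara_measure mu]_(y in cball x r)
    (dim_quotient mu ^~ d)^\+ y)).
  by rewrite -[leRHS]sube0 leeB// integral_ge0.
have BE : cball x r = (E `&` cball x r) `|` (cball x r `\` E).
  by rewrite [E `&` _]setIC setUIDK.
rewrite {1}BE ge0_integral_setU//=; last 2 first.
  by rewrite -BE; apply: measurable_funepos; exact: mq.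
  by apply/disj_setPS => y [[? _] []].
rewrite -[leRHS]addeA; apply: leeD; last first.
  by near: d; apply: (hD x r) => //.
apply: (@le_trans _ _ (\int[cara_measure mu]_(y in E `&` cball x r) cst t%:E y)).
  apply: ge0_le_integral => //; first by apply: measurable_funepos; exact: mq.
  move=> y [Ey _]; rewrite funeposE ge_max lee_fin t0 andbT.
  by apply: Et => //; rewrite d0.
by rewrite integral_cst.
Unshelve. all: by end_near. Qed.

(** Only the positive part on E is kept; the negative part on the whole ball is
    uniformly small. *)
Lemma integral_ball_ge x r E s e' e :
  mu.-caratheodory E -> (0 <= s)%R -> (0 < e')%R ->
  (forall y d, E y -> (0 < d < e')%R -> s%:E <= dim_quotient mu y d) ->
  (0 < e)%R -> \forall d \near (0%R : R)^'+,
    s%:E * mu (E `&` cball x r) - e%:E * mu (cball x r) <=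
    \int[cara_measure mu]_(y in cball x r) dim_quotient mu y d.
Proof.
move=> mE s0 e'0 Es e0.
have mB : mu.-caratheodory (cball x r) by exact: measurable_cball.
have mEB : mu.-caratheodory (E `&` cball x r) by exact: caratheodory_measurable_setI.
near=> d.
have d0 : (0 < d)%R by near: d; exact: nbhs_right_gt.
have de' : (d < e')%R by near: d; exact: nbhs_right_lt.
have mq' B : mu.-caratheodory B -> measurable_fun (B : set (caratheodory_type mu))
    ((dim_quotient mu ^~ d)^\+ : caratheodory_type mu -> \bar R).
  by move=> ?; apply: measurable_funepos; exact: mq.
rewrite integralE; apply: leeB.
  apply: (@le_trans _ _ (\int[cara_measure mu]_(y in E `&` cball x r)
    (dim_quotient mu ^~ d)^\+ y)); last first.
    apply: ge0_subset_integral => //; exact: mq'.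
  rewrite -(@integral_cst _ _ _ (cara_measure mu))//.
  apply: ge0_le_integral => //; first exact: mq'.
  move=> y [Ey _]; rewrite funeposE le_max; apply/orP; left.
  by apply: Es => //; rewrite d0.
rewrite -(@integral_cst _ _ _ (cara_measure mu))//.
apply: ge0_le_integral => //.
- by apply: measurable_funeneg; exact: mq.
- move=> y By; rewrite funenegE ge_max lee_fin (ltW e0) andbT leeNl.
  move: y By; near: d; exact: near0_dim_quotient_ge.
Unshelve. all: by end_near. Qed.

(** Since 0 * 0^-1 = 0 * +oo = 0 in the extended reals, the quotient is 0 at a
    null ball. So a limit equal to 1 also yields that small balls around x have
    positive mass, i.e. that x lies in the support. *)
Lemma density_ball E x e : (0 < e < 1)%R ->
  mu (E `&` cball x r) / mu (cball x r) @[r --> (0%R : R)^'+] --> 1 ->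
  \forall r \near (0%R : R)^'+, 0 < mu (cball x r) /\
    (1 - e)%:E * mu (cball x r) <= mu (E `&` cball x r).
Proof.
move=> /andP[e0 e1] h.
have : \forall r \near (0%R : R)^'+, (1 - e)%:E < mu (E `&` cball x r) / mu (cball x r).
  apply: (h [set u | (1 - e)%:E < u]); apply: open_ereal_gt'.
  by rewrite lte_fin ltrBlDr ltrDl.
apply: filterS => r hr; have B0 : mu (cball x r) != 0.
  apply/eqP => B0; move: hr.
  have -> : mu (E `&` cball x r) = 0.
    apply/eqP; rewrite eq_le outer_measure_ge0 andbT -B0.
    by apply: le_outer_measure; exact: subIsetr.
  by rewrite mul0e lte_fin subr_lt0 ltNge (ltW e1).
have Bgt0 : 0 < mu (cball x r) by rewrite lt0e B0 outer_measure_ge0.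
split=> //.
have Bfin : mu (cball x r) \is a fin_num by rewrite ge0_fin_numE.
move: hr Bgt0 B0; rewrite -(fineK Bfin) => hr Bgt0 B0.
move: hr; rewrite inver; case: eqP => [b0|_]; first by rewrite b0 eqxx in B0.
by rewrite lte_pdivlMr// => /ltW.
Qed.

Lemma entropy_mean_le A d c : 0 < mu A -> mu A < +oo ->
  \int[cara_measure mu]_(y in A) dim_quotient mu y d <= c%:E * mu A ->
  entropy_mean mu A d <= c%:E.
Proof.
move=> A0 Aoo; rewrite /entropy_mean.
have Afin : mu A \is a fin_num by rewrite ge0_fin_numE// ltW.
rewrite -(fineK Afin) inver gt_eqF ?fine_gt0 ?A0// lee_pdivrMl ?fine_gt0 ?A0//.
by rewrite muleC.
Qed.

Lemma entropy_mean_ge A d c : 0 < mu A -> mu A < +oo ->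
  c%:E * mu A <= \int[cara_measure mu]_(y in A) dim_quotient mu y d ->
  c%:E <= entropy_mean mu A d.
Proof.
move=> A0 Aoo; rewrite /entropy_mean.
have Afin : mu A \is a fin_num by rewrite ge0_fin_numE// ltW.
rewrite -(fineK Afin) inver gt_eqF ?fine_gt0 ?A0// lee_pdivlMl ?fine_gt0 ?A0//.
by rewrite muleC.
Qed.

Lemma lower_dim1_loc_ge x E s e' :
  mu.-caratheodory E -> (0 <= s)%R -> (0 < e')%R ->
  (forall y d, E y -> (0 < d < e')%R -> s%:E <= dim_quotient mu y d) ->
  mu (E `&` cball x r) / mu (cball x r) @[r --> (0%R : R)^'+] --> 1 ->
  s%:E <= lower_dim1_loc mu x.
Proof.
move=> mE s0 e'0 Es dens; apply/lee_addgt0Pr => e e0; rewrite -leeBlDr// -EFinB.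
(* Density costs s e1 and the negative part of the quotient costs e1. *)
have s1 : (0 < s + 1)%R by rewrite ltr_wpDl.
pose e1 : R := Num.min (e / (s + 1))%R (1 / 2)%R.
have e1s : (e1 * (s + 1) <= e)%R by rewrite -ler_pdivlMr// ge_min lexx.
have e10 : (0 < e1)%R by rewrite lt_min !divr_gt0.
have e11 : (e1 < 1)%R by rewrite gt_min; apply/orP; right; lra.
apply: limf_einf_ge; near=> r.
have [B0 EB] : 0 < mu (cball x r) /\
    (1 - e1)%:E * mu (cball x r) <= mu (E `&` cball x r).
  by near: r; apply: density_ball => //; rewrite e10.
apply: limf_einf_ge; near=> d.
apply: entropy_mean_ge => //.
apply: (@le_trans _ _ (s%:E * mu (E `&` cball x r) - e1%:E * mu (cball x r))).
  have Bfin : mu (cball x r) \is a fin_num by rewrite ge0_fin_numE// ltW.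
  have EBfin : mu (E `&` cball x r) \is a fin_num by exact: fin_num_sub_cball.
  move: B0 EB; rewrite -(fineK Bfin) -(fineK EBfin) -!EFinM -EFinB lte_fin !lee_fin.
  move=> b0 EB; have := ler_wpM2l s0 EB; have := ler_wpM2r (ltW b0) e1s; nra.
near: d; exact: (@integral_ball_ge x r E s e').
Unshelve. all: by end_near. Qed.

(** The lower bound for the average with the empty set as good set. *)
Lemma lower_dim1_loc_ge0 x : (\forall r \near (0%R : R)^'+, 0 < mu (cball x r)) ->
  0 <= lower_dim1_loc mu x.
Proof.
move=> Bgt0; apply/lee_addgt0Pr => e e0; rewrite -leeBlDr// -EFinB sub0r.
apply: limf_einf_ge; near=> r; apply: limf_einf_ge; near=> d.
apply: entropy_mean_ge => //; first by near: r.
have : 0%:E * mu (set0 `&` cball x r) - e%:E * mu (cball x r) <=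
    \int[cara_measure mu]_(y in cball x r) dim_quotient mu y d.
  near: d; apply: (@integral_ball_ge _ _ _ _ 1%R) => //.
  exact: caratheodory_measurable_set0.
by rewrite set0I outer_measure0 mule0 sub0e EFinN mulNe.
Unshelve. all: by end_near. Qed.

Lemma upper_dim1_loc_le (D : nat) x E t e' :
  entropy_bound D -> mu.-caratheodory E -> (0 <= t)%R -> (0 < e')%R ->
  (forall y d, E y -> (0 < d < e')%R -> dim_quotient mu y d <= t%:E) ->
  mu (E `&` cball x r) / mu (cball x r) @[r --> (0%R : R)^'+] --> 1 ->
  upper_dim1_loc mu x <= t%:E.
Proof.
move=> hD mE t0 e'0 Et dens; apply/lee_addgt0Pr => e e0; rewrite -EFinD.
have D0 : (0 <= D%:R :> R)%R by [].
(* The part of the ball outside E costs D e1, and the error in the integral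
   costs another e1. *)
have D1 : (0 < D%:R + 1 :> R)%R by rewrite ltr_wpDl.
pose e1 : R := Num.min (e / (D%:R + 1))%R (1 / 2)%R.
have e1D : (e1 * (D%:R + 1) <= e)%R by rewrite -ler_pdivlMr// ge_min lexx.
have e10 : (0 < e1)%R by rewrite lt_min !divr_gt0.
have e11 : (e1 < 1)%R by rewrite gt_min; apply/orP; right; lra.
apply: limf_esup_le; near=> r.
have r0 : (0 < r)%R by near: r; exact: nbhs_right_gt.
have [B0 EB] : 0 < mu (cball x r) /\
    (1 - e1)%:E * mu (cball x r) <= mu (E `&` cball x r).
  by near: r; apply: density_ball => //; rewrite e10.
have Bfin : mu (cball x r) \is a fin_num by rewrite ge0_fin_numE// ltW.
have b0 : (0 < fine (mu (cball x r)))%R by rewrite fine_gt0// B0 finB.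
apply: limf_esup_le; near=> d.
apply: entropy_mean_le => //.
apply: (@le_trans _ _ (t%:E * mu (E `&` cball x r) +
    D%:R%:E * mu (cball x r `\` E) + (e1 * fine (mu (cball x r)))%:E)).
  near: d; apply: (@integral_ball_le D x r E t e') => //; exact: mulr_gt0.
have BE := mE (cball x r); rewrite -setDE setIC in BE.
have EBfin : mu (E `&` cball x r) \is a fin_num by exact: fin_num_sub_cball.
have BDfin : mu (cball x r `\` E) \is a fin_num by apply: (@fin_num_sub_cball _ x r).
have BD0 : (0 <= fine (mu (cball x r `\` E)))%R by rewrite fine_ge0// outer_measure_ge0.
move: BE EB BD0; move: (b0); rewrite -(fineK Bfin) -(fineK EBfin) -(fineK BDfin) /=.
set b := fine (mu (cball x r)); set m1 := fine _; set m2 := fine _ => bgt0.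
rewrite -!EFinM -!EFinD => -[bE]; rewrite !lee_fin => EB m20.
have h2 : (m2 <= e1 * b)%R by lra.
have := ler_wpM2l D0 h2; have := ler_wpM2r (ltW bgt0) e1D.
have := mulr_ge0 t0 m20; rewrite bE; nra.
Unshelve. all: by end_near. Qed.

Lemma lower_dim_loc_ge0 x : 0 <= lower_dim_loc mu x.
Proof.
apply/lee_addgt0Pr => e e0; rewrite -leeBlDr// -EFinB sub0r.
apply: limf_einf_ge; near=> d.
have h : forall y, cball x 0 y -> (- e)%:E <= dim_quotient mu y d.
  by near: d; exact: near0_dim_quotient_ge.
by apply: h; exact: cball_center.
Unshelve. all: by end_near. Qed.

End dimension_quotient.

(** * The comparison *)

Unset Implicit Arguments.

Theorem theorem3p11 (R : realType) (X : pmetricType R)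
    (mu : {outer_measure set X -> \bar R}) :
  doubling X ->
  metric_measure mu ->
  density_point_property mu ->
  {ae cara_measure mu, forall x : X,
    [/\ lower_dim_loc mu x <= lower_dim1_loc mu x,
        lower_dim1_loc mu x <= upper_dim1_loc mu x
      & upper_dim1_loc mu x <= upper_dim_loc mu x]}.
Proof.
move=> dX mmu dens.
have [D hD] := doubling_entropy_bound mmu dX.
pose low (i : rat * nat) := [set x | forall d, (0 < d < i.2.+1%:R^-1)%R ->
  (ratr i.1)%:E <= dim_quotient mu x d].
pose upp (i : rat * nat) := [set x | forall d, (0 < d < i.2.+1%:R^-1)%R ->
  dim_quotient mu x d <= (ratr i.1)%:E].
have k1 (k : nat) : (k.+1%:R^-1 <= 1 :> R)%R by rewrite invf_le1// ler1n.
have mlow i : mu.-caratheodory (low i).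
  by apply: closed_caratheodory => //; exact: closed_dim_quotient_ge.
have mupp i : mu.-caratheodory (upp i).
  by apply: closed_caratheodory => //; exact: closed_dim_quotient_le.
have aelow := ae_forall_countable (fun i => dens _ (mlow i)).
have aeupp := ae_forall_countable (fun i => dens _ (mupp i)).
have aeT := dens setT (@measurableT _ (caratheodory_type mu)).
apply: filterS3 aelow aeupp aeT => x xlow xupp xT.
(* Density of the whole space at x puts x in the support. *)
have Bgt0 : \forall r \near (0%R : R)^'+, 0 < mu (cball x r).
  have half01 : (0 < (1 / 2 : R) < 1)%R by lra.
  by apply: filterS (density_ball mmu half01 (xT I)) => r [].
split.
- rewrite leNgt; apply/negP => /(ereal_rat_between (lower_dim1_loc_ge0 mmu Bgt0)).
  move=> [q /andP[q1 q2]].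
  have q0 : (0 <= ratr q :> R)%R.
    by rewrite -lee_fin (le_trans _ (ltW q1))// lower_dim1_loc_ge0.
  have [k hk] := near0_harmonic (limf_einf_gt _ q2).
  have xqk : low (q, k) x by move=> d dk; exact/ltW/hk.
  move: q1; rewrite ltNge => /negP; apply.
  by apply: (@lower_dim1_loc_ge _ _ _ mmu x _ _ k.+1%:R^-1 (mlow (q, k))) => //;
    [move=> y d; apply|exact: xlow].
- apply: le_trans (limf_einf_le_esup _ _) _; apply: le_limf_esup => r.
  exact: limf_einf_le_esup.
- have up0 : 0 <= upper_dim_loc mu x.
    by apply: le_trans (lower_dim_loc_ge0 mmu x) (limf_einf_le_esup _ _).
  rewrite leNgt; apply/negP => /(ereal_rat_between up0)[q /andP[q1 q2]].
  have q0 : (0 <= ratr q :> R)%R by rewrite -lee_fin (le_trans up0)// ltW.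
  have [k hk] := near0_harmonic (limf_esup_lt _ q1).
  have xqk : upp (q, k) x by move=> d dk; exact/ltW/hk.
  move: q2; rewrite ltNge => /negP; apply.
  by apply: (@upper_dim1_loc_le _ _ _ mmu D x _ _ k.+1%:R^-1 hD (mupp (q, k))) => //;
    [move=> y d; apply|exact: xupp].
Qed.
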